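(* Let $C_\phi$ be a composition operator on a directed graph with one circuit (as defined in the context) and suppose that $C_\phi\in\boldsymbol B(L^2(\mu))$ is $2$-isometric. Then $C_\phi$ is $\Delta_{C_\phi}$-regular if and only if $\kappa=1$.
   Context: Setting. $\mathbb N=\{1,2,\ldots\}$. Let $\kappa\in\mathbb N$, $\eta\in\mathbb N\cup\{\infty\}$, $J_{[1,\eta]}=\{i\in\mathbb N: i\le\eta\}$ (so $J_{[1,\infty]}=\mathbb N$), and let $X=\{x_1,\ldots,x_\kappa\}\cup\{x_{i,j}: i\in J_{[1,\eta]},\, j\in\mathbb N\}$, all the listed points being distinct. Let $\mathscr A$ be the $\sigma$-algebra of all subsets of $X$ and $\mu$ a positive measure on $\mathscr A$ with $\mu(x):=\mu(\{x\})\in(0,\infty)$ for all $x\in X$. Define $\phi\colon X\to X$ by $\phi(x_{i,j})=x_{i,j-1}$ for $j\ge2$, $\phi(x_{i,1})=x_\kappa$, $\phi(x_1)=x_\kappa$, and $\phi(x_i)=x_{i-1}$ for $2\le i\le\kappa$. The operator $C_\phi f=f\circ\phi$ in the complex space $L^2(\mu)=L^2(X,\mathscr A,\mu)$ is called a composition operator on a directed graph with one circuit. $C_\phi\in\boldsymbol B(L^2(\mu))$ means that $C_\phi$ is everywhere defined and bounded on $L^2(\mu)$. A bounded operator $T$ on a Hilbert space is $2$-isometric if $I-2T^*T+T^{*2}T^2=0$. For a $2$-isometric operator $T$ the operator $\Delta_T:=T^*T-I$ is positive; $T$ is called $\Delta_T$-regular if $\Delta_T T=\Delta_T^{1/2}\,T\,\Delta_T^{1/2}$,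 where $\Delta_T^{1/2}$ is the positive square root. *)

(* Defs.v *)
From HB Require Import structures.
From mathcomp Require Import all_boot all_order all_algebra.
From mathcomp Require Import complex ring lra.
From mathcomp Require Import all_classical all_reals all_analysis.

Set Implicit Arguments.
Unset Strict Implicit.
Unset Printing Implicit Defensive.

Import Order.TTheory GRing.Theory Num.Theory.
Import ComplexField.Normc.

Local Open Scope ring_scope.
Local Open Scope classical_set_scope.

(* Bounded operators on a complex inner product space U.  The adjoint and the
   positive square root are picked among the operators that characterize them;
   when U is complete they exist and are unique, respectively for bounded and
   for positive bounded operators. *)
Section operators.
Variables (C : numClosedFieldType) (U : lmodType C).
Variable dot : {dot U for (@Num.conj C)}.
Implicit Types (T S A B : U -> U).

Definition hnorm (x : U) : C := sqrtC (dot x x).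

Definition bounded_operator T :=
  linear T /\ exists M : C, forall x, hnorm (T x) <= M * hnorm x.

Definition is_adjoint T S :=
  bounded_operator S /\ forall x y, dot (T x) y = dot x (S y).

Definition adjoint T : U -> U := xget (cst 0) [set S | is_adjoint T S].

(* In the order of a numClosedFieldType, 0 <= z says that z is a nonnegative
   real number. *)
Definition positive_operator A := forall x, 0 <= dot (A x) x.

Definition is_positive_sqrt A B :=
  [/\ bounded_operator B, positive_operator B & forall x, B (B x) = A x].

Definition op_sqrt A : U -> U := xget (cst 0) [set B | is_positive_sqrt A B].

Definition two_isometric T := forall x,
  x - (adjoint T (T x)) *+ 2 + adjoint T (adjoint T (T (T x))) = 0.

Definition Delta T : U -> U := fun x => adjoint T (T x) - x.

Definition Delta_regular T := forall x,
  Delta T (T x) = op_sqrt (Delta T) (T (op_sqrt (Delta T) x)).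

End operators.

(* The vertices, with all indices shifted to start from 0: [Circ i] is
   x_{i+1} and [Branch i j] is x_{i+1,j+1}.  eta = None stands for
   eta = oo. *)
Definition in_branches (eta : option nat) : pred nat :=
  fun i => if eta is Some n then (i < n)%N else true.

Definition branch_index (eta : option nat) := {i : nat | in_branches eta i}.

(* The proof hk is a parameter so that the type is nonempty, as measurable
   types have to be. *)
Inductive vertex (kappa : nat) (hk : (0 < kappa)%N) (eta : option nat) : Type :=
| Circ of 'I_kappa
| Branch of branch_index eta & nat.
Arguments Circ {kappa hk eta}.
Arguments Branch {kappa hk eta}.

Section vertex_instances.
Variables (kappa : nat) (hk : (0 < kappa)%N) (eta : option nat).

Definition sum_of_vertex (x : vertex hk eta) :
    'I_kappa + branch_index eta * nat :=
  match x with Circ i => inl i | Branch i j => inr (i, j) end.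

Definition vertex_of_sum (s : 'I_kappa + branch_index eta * nat) :
    vertex hk eta :=
  match s with inl i => Circ i | inr (i, j) => Branch i j end.

Lemma sum_of_vertexK : cancel sum_of_vertex vertex_of_sum.
Proof. by case. Qed.

HB.instance Definition _ :=
  Countable.copy (vertex hk eta) (can_type sum_of_vertexK).

HB.instance Definition _ :=
  isPointed.Build (vertex hk eta) (Circ (Ordinal hk)).

HB.instance Definition _ := @isMeasurable.Build default_measure_display
  (vertex hk eta) discrete_measurable discrete_measurable0
  discrete_measurableC discrete_measurableU.

End vertex_instances.

(* [ord_pred] is the cyclic predecessor: it sends the index 0 of x_1 to the
   index kappa.-1 of x_kappa. *)
Definition phi kappa (hk : (0 < kappa)%N) eta (x : vertex hk eta) :
    vertex hk eta :=
  match x with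
  | Circ i => Circ (ord_pred i)
  | Branch _ 0 => Circ (Ordinal (etrans (ltn_predL kappa) hk))
  | Branch i j.+1 => Branch i j
  end.

Section L2.
Variables (R : realType) (kappa : nat) (hk : (0 < kappa)%N) (eta : option nat).
Local Notation X := (vertex hk eta).
Variable mu : {measure set X -> \bar R}.

(* [R[i]^o] selects the structure of R[i] as a module over itself. *)
Definition square_integrable : {pred X -> R[i]^o} :=
  fun f => `[< mu.-integrable setT (fun x => (normc (f x) ^+ 2)%:E) >].

Lemma measurable_vertex d (Y : measurableType d) (D : set X) (f : X -> Y) :
  measurable_fun D f.
Proof. by []. Qed.

Lemma le_integrable_vertex (f g : X -> R) :
  (forall x, `|f x| <= g x) ->
  mu.-integrable setT (EFin \o g) -> mu.-integrable setT (EFin \o f).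
Proof.
move=> fg; apply: le_integrable => // x _.
by rewrite /= lee_fin (le_trans (fg x))// ler_norm.
Qed.

Let sqr_normc (z : R[i]) : normc z ^+ 2 = complex.Re z ^+ 2 + complex.Im z ^+ 2.
Proof. by case: z => a b /=; rewrite sqr_sqrtr// addr_ge0 ?sqr_ge0. Qed.

Lemma square_integrable_submod_closed : submod_closed square_integrable.
Proof.
split.
  apply/asboolP; under eq_fun do rewrite normc0 expr0n/=.
  exact: integrable0.
move=> a f g /asboolP hf /asboolP hg; apply/asboolP.
apply: (@le_integrable_vertex _
  (fun x => 2 * normc a ^+ 2 * normc (f x) ^+ 2 + 2 * normc (g x) ^+ 2)).
  move=> x; rewrite ger0_norm ?sqr_ge0//.
  change ((a *: f + g) x) with (a * f x + g x).
  rewrite -mulrA -exprMn -normcM; move: (a * f x) (g x : R[i]) => [p q] [r s].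
  by rewrite !sqr_normc/=; move: (sqr_ge0 (p - r)) (sqr_ge0 (q - s)); nra.
have -> : EFin \o (fun x => 2 * normc a ^+ 2 * normc (f x) ^+ 2 +
      2 * normc (g x) ^+ 2) =
    (fun x => ((2 * normc a ^+ 2)%:E * (normc (f x) ^+ 2)%:E)%E) \+
    (fun x => (2%:E * (normc (g x) ^+ 2)%:E)%E).
  by apply/funext => x.
by apply: integrableD => //; exact: integrableZl.
Qed.

HB.instance Definition _ := GRing.isSubmodClosed.Build _ _ square_integrable
  square_integrable_submod_closed.

(* No quotient by equality almost everywhere is taken: below, every point has
   positive measure. *)
Definition L2 := {f : X -> R[i]^o | f \in square_integrable}.

HB.instance Definition _ := SubType.on L2.
HB.instance Definition _ := Choice.on L2.
HB.instance Definition _ := [SubChoice_isSubLmodule of L2 by <:].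

Definition fun_of_L2 (f : L2) : X -> R[i] := val f.
Coercion fun_of_L2 : L2 >-> Funclass.

Lemma L2_integrable (f : L2) :
  mu.-integrable setT (fun x => (normc (f x) ^+ 2)%:E).
Proof. exact/asboolP/(valP f). Qed.

Definition L2_inner (f g : L2) : R[i] :=
  ((\int[mu]_x complex.Re (f x * (g x)^*)) +i*
   (\int[mu]_x complex.Im (f x * (g x)^*)))%C.

Let conjE (z : R[i]) : z^* = conjc z. Proof. by []. Qed.

Lemma L2_mul_integrable (f g : L2) :
  mu.-integrable setT (fun x => (complex.Re (f x * (g x)^*))%:E) /\
  mu.-integrable setT (fun x => (complex.Im (f x * (g x)^*))%:E).
Proof.
have hfg : mu.-integrable setT
    (EFin \o (fun x => normc (f x) ^+ 2 + normc (g x) ^+ 2)).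
  have -> : EFin \o (fun x => normc (f x) ^+ 2 + normc (g x) ^+ 2) =
    (fun x => (normc (f x) ^+ 2)%:E) \+ (fun x => (normc (g x) ^+ 2)%:E).
    by [].
  by apply: integrableD => //; exact: L2_integrable.
split; apply: le_integrable_vertex hfg => x.
  rewrite !sqr_normc conjE; case: (f x) (g x) => p q [r s] /=.
  move: (sqr_ge0 (p - r)) (sqr_ge0 (q - s)) (sqr_ge0 (p + r)) (sqr_ge0 (q + s)).
  by rewrite ler_norml => *; apply/andP; split; nra.
rewrite !sqr_normc conjE; case: (f x) (g x) => p q [r s] /=.
move: (sqr_ge0 (p - s)) (sqr_ge0 (q - r)) (sqr_ge0 (p + s)) (sqr_ge0 (q + r)).
by rewrite ler_norml => *; apply/andP; split; nra.
Qed.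

Let intZ (k : R) (h : X -> R) : mu.-integrable setT (EFin \o h) ->
  mu.-integrable setT (EFin \o (fun x => k * h x)).
Proof. exact: integrableZl. Qed.

Let intD (h h' : X -> R) : mu.-integrable setT (EFin \o h) ->
  mu.-integrable setT (EFin \o h') ->
  mu.-integrable setT (EFin \o (fun x => h x + h' x)).
Proof. exact: integrableD. Qed.

Let intB (h h' : X -> R) : mu.-integrable setT (EFin \o h) ->
  mu.-integrable setT (EFin \o h') ->
  mu.-integrable setT (EFin \o (fun x => h x - h' x)).
Proof. exact: integrableB. Qed.

Let L2E (a : R[i]) (f g : L2) x : fun_of_L2 (a *: f + g) x = a * f x + g x.
Proof. by []. Qed.

Let L2_innerPl a (f1 f2 g : L2) :
  L2_inner (a *: f1 + f2) g = a * L2_inner f1 g + L2_inner f2 g.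
Proof.
rewrite /L2_inner.
have [r1 i1] := L2_mul_integrable f1 g.
have [r2 i2] := L2_mul_integrable f2 g.
case: a => a b; apply/eqP; rewrite eq_complex/=; apply/andP; split; apply/eqP.
  transitivity (\int[mu]_x ((a * complex.Re (f1 x * (g x)^*) -
      b * complex.Im (f1 x * (g x)^*)) + complex.Re (f2 x * (g x)^*))).
    apply: eq_Rintegral => x _; rewrite L2E.
    by rewrite conjE; case: (f1 x) (f2 x) (g x) => p q [r s] [t u] /=; ring.
  rewrite RintegralD//; last by apply: intB; exact: intZ.
  by rewrite RintegralB ?RintegralZl//; exact: intZ.
transitivity (\int[mu]_x ((a * complex.Im (f1 x * (g x)^*) +
    b * complex.Re (f1 x * (g x)^*)) + complex.Im (f2 x * (g x)^*))).
  apply: eq_Rintegral => x _; rewrite L2E.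
  by rewrite conjE; case: (f1 x) (f2 x) (g x) => p q [r s] [t u] /=; ring.
rewrite RintegralD//; last by apply: intD; exact: intZ.
by rewrite RintegralD ?RintegralZl//; exact: intZ.
Qed.

Lemma L2_inner_linearl (g : L2) : linear_for *%R (L2_inner^~ g).
Proof. by move=> a f1 f2; exact: L2_innerPl. Qed.

Lemma L2_inner_conj (f g : L2) : L2_inner f g = (L2_inner g f)^*.
Proof.
rewrite conjE /L2_inner/=; congr (_ +i* _)%C.
  apply: eq_Rintegral => x _; rewrite conjE.
  by case: (f x) (g x) => p q [r s] /=; ring.
have [_ i1] := L2_mul_integrable g f.
rewrite -mulN1r -RintegralZl//; apply: eq_Rintegral => x _; rewrite conjE.
by case: (f x) (g x) => p q [r s] /=; ring.
Qed.

Lemma L2_inner_linearr (f : L2) :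
  linear_for (Num.conj \; *%R) (L2_inner f).
Proof.
move=> a g1 g2; rewrite L2_inner_conj L2_innerPl rmorphD rmorphM.
by rewrite /= -!L2_inner_conj.
Qed.

HB.instance Definition _ := bilinear_isBilinear.Build R[i] L2 L2 R[i]
  *%R (Num.conj \; *%R) L2_inner (L2_inner_linearl, L2_inner_linearr).

Let L2_inner_hermitian (f g : L2) :
  L2_inner f g = (-1) ^+ false * (L2_inner g f)^*.
Proof. by rewrite mul1r -L2_inner_conj. Qed.

HB.instance Definition _ := isHermitianSesquilinear.Build R[i] L2 false
  Num.conj L2_inner L2_inner_hermitian.

Section positive_masses.
Hypothesis hmu : forall x : X, (0 < mu [set x] < +oo)%E.

Lemma L2_inner_gt0 (f : L2) : f != 0 -> 0 < L2_inner f f.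
Proof.
move=> f0; have [x0 fx0] : exists x0, (f : X -> R[i]) x0 != 0.
  apply: contrapT => /forallNP fx; move/negP: f0; apply; apply/eqP/val_inj.
  by apply/funext => x; apply/eqP; apply: contrapT => /negP /fx.
have reE x : complex.Re (f x * (f x)^*) = normc (f x) ^+ 2.
  by rewrite sqr_normc conjE; case: (f x) => p q /=; ring.
have imE x : complex.Im (f x * (f x)^*) = 0.
  by rewrite conjE; case: (f x) => p q /=; ring.
rewrite ltcE /L2_inner/=; apply/andP; split.
  by under eq_Rintegral do rewrite imE; rewrite /Rintegral integral0.
under eq_Rintegral do rewrite reE.
rewrite /Rintegral fine_gt0//; apply/andP; split; last first.
  have := integrable_fin_num measurableT (L2_integrable f).
  by rewrite fin_numElt => /andP[].
apply: (@lt_le_trans _ _ (\int[mu]_(x in [set x0]) (normc (f x) ^+ 2)%:E)%E).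
  rewrite (eq_integral (cst (normc (f x0) ^+ 2)%:E)); last first.
    by move=> x /set_mem ->.
  rewrite integral_cst//; case/andP: (hmu x0) => m0 _.
  rewrite mule_gt0// lte_fin exprn_even_gt0//=.
  by apply: contra_neq fx0 => /eq0_normc.
apply: ge0_subset_integral => // x _; exact: sqr_ge0.
Qed.

Definition L2_dot : {dot L2 for Num.conj} :=
  HB.pack L2_inner (isDotProduct.Build R[i] L2 L2_inner L2_inner_gt0).

End positive_masses.

(* T is C_psi, everywhere defined on L2. *)
Definition is_composition_operator (psi : X -> X) (T : L2 -> L2) :=
  forall f x, T f x = f (psi x).

End L2.

(* Main.v *)
Require Import Defs.
From mathcomp Require Import all_boot all_order all_algebra.
From mathcomp Require Import complex ring zify.
From mathcomp Require Import all_classical all_reals all_analysis.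

(** Write [T] for the composition operator and [e_x] for the indicator of the
    point [x].  Everything reduces to the numbers
    [defect x = <Delta_T e_x, e_x> = mu(phi^-1(x)) - mu(x)].

    The operator [Delta_T] is diagonal: it is the multiplication by
    [Delta_symbol x = defect x / mu(x)].  As [T] is 2-isometric, [Delta_T] is
    positive, so its positive square root is the multiplication by the square
    roots of the symbol, and comparing both sides of the regularity equation
    on [e_(phi x)] shows that [T] is [Delta_T]-regular if and only if, at every
    [x], the symbol vanishes at [x] or takes the same value at [x] and at
    [phi x] ([Delta_regular_symbol]).

    The 2-isometry says that [<Delta_T T f, T f> = <Delta_T f, f>].  When [x]
    has a single preimage [y], [T e_x = e_y], so that
    [defect y = defect x] and [mu(y) = mu(x) + defect x].

    If [kappa = 1], the only circuit vertex [x_1] is a fixed point of [phi], and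
    [T e_(x_1) = e_(x_1) + g], where [g] is carried by the first branch
    vertices.  As [Delta_T] is diagonal, the invariance gives
    [<Delta_T g, g> = 0]: the symbol vanishes at these vertices
    ([defect_preimage_fixpoint]), hence all along the branches.  It is thus
    concentrated at a fixed point of [phi], and [T] is regular.

    If [kappa > 1], the defect is constant along the circuit, with a value [D].
    Regularity at [x_kappa] says that [D = 0] or that the symbols at [x_kappa]
    and [x_(kappa-1)] are equal.  If [D] were not zero, both vertices would then
    have the same mass; but [D] is the difference of these masses.  So [D = 0],
    hence all circuit vertices have the same mass, and
    [mu(phi^-1(x_kappa)) = mu(x_kappa)].  But [phi^-1(x_kappa)] contains [x_1],
    which already has that mass, and at least one branch vertex: a contradiction. *)

Import Order.TTheory GRing.Theory Num.Theory.
Import ComplexField.Normc.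

Local Open Scope ring_scope.
Local Open Scope classical_set_scope.

(** * Positive operators and 2-isometries *)

Section positive_operators.
Context {C : numClosedFieldType} {U : lmodType C}.
Variable dot : {dot U for (@Num.conj C)}.
Implicit Types (B T : U -> U) (x y z : U) (l : C).

Lemma dotC x y : dot x y = (dot y x)^*.
Proof. by rewrite hermC mul1r. Qed.

(** Over the complex numbers a positive operator is symmetric: by
    polarization, as the quadratic form takes real values. *)
Lemma positive_symmetric {B} : linear B -> positive_operator dot B ->
  forall x y, dot (B x) y = dot x (B y).
Proof.
move=> linB posB x y; rewrite [RHS]dotC.
set a := dot (B x) y; set b := dot (B y) x.
have realB z : dot (B z) z \is Num.real by exact: ger0_real.
have form_expand c : c^* * a + c * b \is Num.real.
  have -> : c^* * a + c * b = dot (B (c *: y + x)) (c *: y + x)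
      - dot (B x) x - c * c^* * dot (B y) y.
    rewrite linB !(linearDl, linearDr) !(linearZl_LR, linearZr_LR) /= -/a -/b.
    by rewrite /GRing.scale/=; ring.
  rewrite !rpredB// rpredM// -normCK ?realX//; exact/rpredX/normr_real.
(* The coefficients 1 and 'i determine dot (B x) y and dot (B y) x. *)
have /CrealP := form_expand 1; rewrite rmorph1 !mul1r rmorphD => ab.
have /CrealP := form_expand 'i.
rewrite rmorphD !rmorphM/= conjCK conjCi mulNr [LHS]addrC mulNr => iab.
have {}iab : a^* - b^* = b - a.
  apply: (mulfI (neq0Ci C)).
  by rewrite !mulrBr addrC -[RHS]addrC -iab addrC.
apply/eqP; rewrite -subr_eq0; apply/eqP.
have : (a - b^*) *+ 2 = 0.
  rewrite mulr2n; transitivity (a + b - (a^* + b^*) + (a^* - b^* - (b - a))).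
    by ring.
  by rewrite -ab iab !subrr addr0.
by move/eqP; rewrite mulrn_eq0 => /eqP.
Qed.

(** The uniqueness of positive square roots, eigenvector by eigenvector.  If
    [l > 0], then [g = B x - sqrt l x] satisfies [B g = - sqrt l g], which
    positivity only allows for [g = 0]; if [l = 0], the symmetry of [B] gives
    [|B x|^2 = <B (B x), x> = 0]. *)
Lemma positive_sqrt_eigenvector {B l x} : linear B -> positive_operator dot B ->
  0 <= l -> B (B x) = l *: x -> B x = sqrtC l *: x.
Proof.
move=> linB posB l0 BBx; have symB := positive_symmetric linB posB.
have B0 : B 0 = 0 by have := linB (-1) 0 0; rewrite scaler0 addr0 scaleN1r addNr.
have [l_eq0|l_neq0] := eqVneq l 0.
  rewrite l_eq0 sqrtC0 scale0r; apply/eqP; rewrite -(dnorm_eq0 dot).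
  by rewrite -symB BBx l_eq0 scale0r linear0l.
set g := B x - sqrtC l *: x.
have Bg : B g = - sqrtC l *: g.
  rewrite /g addrC -scaleNr linB BBx -[X in X *: x](sqrtCK l).
  by rewrite scalerDr scalerA mulrNN expr2 addrC.
have := posB g; rewrite Bg linearZl_LR/= mulNr oppr_ge0.
rewrite pmulr_rle0 ?lt_def ?sqrtC_ge0 ?sqrtC_eq0 ?l_neq0//.
move=> g_le0; apply/subr0_eq/eqP.
by rewrite -(dnorm_eq0 dot) eq_le g_le0 dnorm_ge0.
Qed.

(** If [T] had no adjoint, [adjoint dot T] would take its default value, the
    zero operator, for which the equation of 2-isometries reads [x = 0]. *)
Lemma two_isometric_adjointP {T x0} : x0 != 0 -> two_isometric dot T ->
  forall x y, dot (T x) y = dot x (adjoint dot T y).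
Proof.
move=> x0_neq0 isoT.
suff [] : is_adjoint dot T (adjoint dot T) by [].
apply: xgetPex; apply: contrapT => noadj; move/eqP: x0_neq0; apply.
have := isoT x0; rewrite /adjoint xgetPN; last first.
  by move=> S adjS; apply: noadj; exists S.
by rewrite /cst mul0rn subr0 addr0.
Qed.

Section two_isometries.
Context {T : U -> U}.
Hypothesis adjT : forall x y, dot (T x) y = dot x (adjoint dot T y).

Lemma dot_Delta x y : dot (Delta dot T x) y = dot (T x) (T y) - dot x y.
Proof. by rewrite linearBl/= dotC -adjT -dotC. Qed.

(** This is the equation of 2-isometries in the form
    [T^* Delta_T T = Delta_T]. *)
Lemma two_isometric_dot_Delta : two_isometric dot T ->
  forall x, dot (Delta dot T (T x)) (T x) = dot (Delta dot T x) x.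
Proof.
move=> isoT x; rewrite !dot_Delta; apply/eqP; rewrite -subr_eq0; apply/eqP.
have eq0 : dot x x - dot (T x) (T x) *+ 2 + dot (T (T x)) (T (T x)) = 0.
  have := congr1 (dot^~ x) (isoT x).
  rewrite linearDl linearBl linearMnl linear0l /= [X in _ - X *+ 2]dotC.
  by rewrite -adjT -dotC [X in _ + X]dotC -!adjT -dotC.
by rewrite -[RHS]eq0; ring.
Qed.

Lemma two_isometric_dot_iter : two_isometric dot T -> forall x n,
  dot (iter n T x) (iter n T x) = dot x x + n%:R * dot (Delta dot T x) x.
Proof.
move=> isoT x n.
have DeltaE k : dot (Delta dot T (iter k T x)) (iter k T x)
    = dot (Delta dot T x) x.
  by elim: k => // k IHk; rewrite iterS two_isometric_dot_Delta.
elim: n => [|n IHn]; first by rewrite mul0r addr0.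
have := DeltaE n; rewrite dot_Delta IHn => /(canRL (subrK _)) ->.
by rewrite -natr1; ring.
Qed.

End two_isometries.

End positive_operators.

Lemma affine_ge0_slope {R : realType} (a d : R[i]) :
  (forall n, 0 <= a + n%:R * d) -> 0 <= d.
Proof.
move=> affine_ge0; have a_ge0 := affine_ge0 0; rewrite mul0r addr0 in a_ge0.
have d_real : d \is Num.real.
  have := ger0_real (affine_ge0 1); rewrite mul1r.
  by move=> /rpredB /(_ (ger0_real a_ge0)); rewrite addrC addKr.
have /complex_realP[k dE] := d_real.
have /complex_realP[b aE] := ger0_real a_ge0.
rewrite {d d_real}dE {a}aE in a_ge0 affine_ge0 *.
have {}affine_ge0 n : 0 <= b + n%:R * k.
  have := affine_ge0 n.
  by rewrite -(rmorph_nat (real_complex R)) -rmorphM -rmorphD lecR.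
rewrite !lecR in a_ge0 *; rewrite leNgt; apply/negP => k_lt0.
have := affine_ge0 (Num.bound (b / - k)); apply/negP; rewrite -ltNge.
rewrite -ltrBDl sub0r ltrNr -mulrN -ltr_pdivrMr ?oppr_gt0//.
by rewrite archi_boundP// divr_ge0// oppr_ge0 ltW.
Qed.

(** The affine function [n |-> |T^n x|^2] is nonnegative, so its slope
    [<Delta_T x, x>] cannot be negative. *)
Lemma two_isometric_Delta_ge0 {R : realType} {U : lmodType R[i]}
    (dot : {dot U for (@Num.conj R[i])}) (T : U -> U) :
  (forall x y, dot (T x) y = dot x (adjoint dot T y)) ->
  two_isometric dot T -> positive_operator dot (Delta dot T).
Proof.
move=> adjT isoT x; apply: (@affine_ge0_slope _ (dot x x)) => n.
by rewrite -(two_isometric_dot_iter dot adjT isoT) dnorm_ge0.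
Qed.

(** * Point masses and diagonal operators *)

Section L2_vertices.
Context {R : realType} {kappa : nat} {hk : (0 < kappa)%N} {eta : option nat}.
Local Notation X := (vertex hk eta).
Context {mu : {measure set X -> \bar R}}.
Implicit Types (f g : L2 mu) (x y : X).

Lemma L2_ext f g : f =1 g -> f = g.
Proof. by move=> fg; apply/val_inj/funext. Qed.

Lemma L2_addE f g x : fun_of_L2 (f + g) x = f x + g x. Proof. by []. Qed.
Lemma L2_subE f g x : fun_of_L2 (f - g) x = f x - g x. Proof. by []. Qed.
Lemma L2_scaleE a f x : fun_of_L2 (a *: f) x = a * f x. Proof. by []. Qed.

Lemma L2_inner_eq f g f' g' :
  (forall x, f x * (g x)^* = f' x * (g' x)^*) ->
  L2_inner f g = L2_inner f' g'.
Proof.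
move=> fg; rewrite /L2_inner.
by congr (_ +i* _)%C; apply: eq_Rintegral => x _; rewrite fg.
Qed.

Lemma L2_inner_ge0 f g :
  (forall x, 0 <= f x * (g x)^*) -> 0 <= L2_inner f g.
Proof.
move=> fg_ge0; rewrite lecE /L2_inner /=; apply/andP; split.
  under eq_Rintegral => x _.
    have := fg_ge0 x; rewrite lecE => /andP[/eqP -> _]; over.
  by rewrite /Rintegral integral0.
apply: Rintegral_ge0 => x _.
by have := fg_ge0 x; rewrite lecE => /andP[].
Qed.

Hypothesis hmu : forall x : X, (0 < mu [set x] < +oo)%E.
Local Notation dot := (L2_dot hmu).

Lemma square_integrable_point x :
  ((fun y => (y == x)%:R) : X -> R[i]^o) \in square_integrable mu.
Proof.
apply/asboolP; rewrite [X in _.-integrable _ X](_ : _ = EFin \o \1_[set x]).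
  apply/integrableP; split; first by [].
  under eq_integral => y _ do rewrite gee0_abs ?lee_fin//.
  rewrite integral_indic// setIT.
  by have /andP[] := hmu x.
apply/funext => y /=; rewrite indicE classical_sets.in_set1.
by case: eqP => _; rewrite ?normc1 ?normc0 ?expr1n ?expr0n.
Qed.

Definition point_mass x : L2 mu :=
  exist (fun h => h \in square_integrable mu) _ (square_integrable_point x).

Lemma point_massE x y : point_mass x y = (y == x)%:R.
Proof. by []. Qed.

Lemma point_mass_neq0 x : point_mass x != 0.
Proof.
apply/eqP => /(congr1 (fun f => fun_of_L2 f x)); rewrite point_massE eqxx.
by move/eqP; rewrite oner_eq0.
Qed.

Lemma dot_point_mass f x :
  dot f (point_mass x) = f x * dot (point_mass x) (point_mass x).
Proof.
transitivity (dot (f x *: point_mass x) (point_mass x)); last first.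
  by rewrite linearZl_LR.
apply: L2_inner_eq => y; rewrite L2_scaleE point_massE.
by have [->|_] := eqVneq; rewrite ?mulr1 // !rmorph0 !mulr0.
Qed.

(** Identities between functions are proved weakly, by pairing with point
    masses; this avoids computing any integral. *)
Lemma dot_eq_point_mass f g x :
  dot f (point_mass x) = dot g (point_mass x) -> f x = g x.
Proof.
rewrite (dot_point_mass f) (dot_point_mass g); apply: mulIf.
by rewrite (dnorm_eq0 dot) point_mass_neq0.
Qed.

Lemma dot_disjoint f g : (forall x, (f x == 0) || (g x == 0)) -> dot f g = 0.
Proof.
move=> fg; rewrite -(linear0l dot g).
apply: L2_inner_eq => x; rewrite -[fun_of_L2 0 x]/0 mul0r.
by case/orP: (fg x) => /eqP ->; rewrite ?rmorph0 ?mul0r ?mulr0.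
Qed.

Section diagonal_operators.
Context {A : L2 mu -> L2 mu} {l : X -> R[i]}.
Hypothesis A_diag : forall f x, A f x = l x * f x.
Hypothesis l_ge0 : forall x, 0 <= l x.

Let sqrt_ge0 x : 0 <= sqrtC (l x). Proof. by rewrite sqrtC_ge0. Qed.

(** The square of the modulus of [sqrt l f] is [(A f) f^*], which is integrable
    because [A f] and [f] are in [L2]. *)
Lemma sqrt_mul_square_integrable f :
  ((fun x => sqrtC (l x) * f x) : X -> R[i]^o) \in square_integrable mu.
Proof.
apply/asboolP; have [+ _] := L2_mul_integrable (A f) f.
congr (_.-integrable _ _); apply/funext => x; congr _%:E.
transitivity (complex.Re (`|sqrtC (l x) * f x| ^+ 2)).
  by rewrite normrM exprMn [`|f x| ^+ 2]normCK ger0_norm// sqrtCK mulrA A_diag.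
rewrite -/(normc _); set z := sqrtC _ * _.
by rewrite [`|z|](_ : _ = (normc z)%:C%C)// -rmorphXn.
Qed.

Definition sqrt_mul f : L2 mu :=
  exist (fun h => h \in square_integrable mu) _ (sqrt_mul_square_integrable f).

Lemma sqrt_mulE f x : sqrt_mul f x = sqrtC (l x) * f x.
Proof. by []. Qed.

(** The operator [T] serves to bound the square root:
    [|sqrt l f|^2 = <A f, f> <= |T f|^2]. *)
Lemma sqrt_mul_is_positive_sqrt {T} : bounded_operator dot T ->
  (forall f, dot (A f) f <= dot (T f) (T f)) -> is_positive_sqrt dot A sqrt_mul.
Proof.
move=> [_ [M T_bounded]] A_le; split.
- split.
    move=> a f g; apply: L2_ext => x.
    by rewrite L2_addE L2_scaleE !sqrt_mulE L2_addE L2_scaleE mulrDr mulrCA.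
  exists M => f; apply: le_trans (T_bounded f).
  rewrite /hnorm ler_sqrtC ?nnegrE ?dnorm_ge0//; apply: le_trans (A_le f).
  rewrite le_eqVlt; apply/orP; left; apply/eqP.
  apply: L2_inner_eq => x; rewrite sqrt_mulE A_diag.
  by rewrite rmorphM/= geC0_conj// mulrACA -expr2 sqrtCK mulrA.
- move=> f; apply: L2_inner_ge0 => x.
  by rewrite sqrt_mulE -mulrA -normCK mulr_ge0// exprn_ge0.
- move=> f; apply: L2_ext => x.
  by rewrite A_diag !sqrt_mulE mulrA -expr2 sqrtCK.
Qed.

(** Point masses are eigenvectors of [A], so that every positive square root
    of [A] acts on them, hence everywhere by symmetry, as the diagonal one. *)
Lemma op_sqrt_diagonal {T} : bounded_operator dot T ->
  (forall f, dot (A f) f <= dot (T f) (T f)) ->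
  forall f x, fun_of_L2 (op_sqrt dot A f) x = sqrtC (l x) * f x.
Proof.
move=> bndT A_le f x.
have [[linB _] posB BB] : is_positive_sqrt dot A (op_sqrt dot A).
  by apply: xgetPex; exists sqrt_mul; exact: sqrt_mul_is_positive_sqrt bndT A_le.
rewrite -(L2_scaleE _ f); apply: dot_eq_point_mass.
rewrite (positive_symmetric dot linB posB).
rewrite (positive_sqrt_eigenvector dot linB posB (l_ge0 x)); last first.
  apply: L2_ext => y; rewrite BB A_diag L2_scaleE point_massE.
  by have [->|_] := eqVneq; rewrite // !mulr0.
by rewrite linearZl_LR linearZr_LR/= geC0_conj.
Qed.

Lemma diagonal_form_ge0 f : 0 <= dot (A f) f.
Proof.
by apply: L2_inner_ge0 => x; rewrite A_diag -mulrA -normCK mulr_ge0// exprn_ge0.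
Qed.

(** Removing from [f] its value at [y] leaves a function supported off [y],
    and a diagonal form has no cross terms between disjoint supports. *)
Lemma diagonal_form_split {f y} : f y = 1 ->
  dot (A f) f = dot (A (point_mass y)) (point_mass y)
    + dot (A (f - point_mass y)) (f - point_mass y).
Proof.
move=> fy; set e := point_mass y; set r : L2 mu := f - e.
have r_e z : (r z == 0) || (e z == 0).
  rewrite L2_subE point_massE.
  by have [->|_] := eqVneq z y; rewrite ?fy ?subrr ?eqxx ?orbT.
have fE : f = e + r by rewrite addrC subrK.
clearbody r.
have AfE : A f = A e + A r.
  by apply: L2_ext => x; rewrite L2_addE !A_diag fE -mulrDr.
have -> : dot (A f) f = dot (A e) e + dot (A e) r + (dot (A r) e + dot (A r) r).
  by rewrite AfE [X in dot _ X]fE linearDl !linearDr.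
rewrite (@dot_disjoint (A e) r) ?(@dot_disjoint (A r) e) ?add0r ?addr0// => x.
  by rewrite A_diag mulf_eq0; case/orP: (r_e x) => ->; rewrite ?orbT.
by rewrite A_diag mulf_eq0; case/orP: (r_e x) => ->; rewrite ?orbT.
Qed.

Lemma diagonal_form_ge2 {f y z} : y != z -> f y = 1 -> f z = 1 ->
  dot (A (point_mass y)) (point_mass y) + dot (A (point_mass z)) (point_mass z)
    <= dot (A f) f.
Proof.
move=> yz fy fz; rewrite (diagonal_form_split fy) lerD2l.
rewrite (@diagonal_form_split (f - point_mass y) z) ?lerDl ?diagonal_form_ge0//.
by rewrite L2_subE point_massE fz eq_sym (negbTE yz) subr0.
Qed.

End diagonal_operators.

(** * The symbol of a 2-isometric composition operator *)

Section composition_operators.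
Context {psi : X -> X} {T : L2 mu -> L2 mu}.
Hypothesis T_psi : is_composition_operator psi T.
Hypothesis bndT : bounded_operator dot T.
Hypothesis isoT : two_isometric dot T.

(** The mass of [x], as an element of [R[i]]. *)
Definition weight x := dot (point_mass x) (point_mass x).

(** As [T e_x] is the indicator of [psi^-1(x)], this is
    [mu(psi^-1(x)) - mu(x)]. *)
Definition defect x := dot (Delta dot T (point_mass x)) (point_mass x).

Definition Delta_symbol x := defect x / weight x.

Lemma weight_gt0 x : 0 < weight x.
Proof. by rewrite (dnorm_gt0 dot) point_mass_neq0. Qed.

Let adjT : forall f g, dot (T f) g = dot f (adjoint dot T g).
Proof. exact: two_isometric_adjointP (point_mass_neq0 point) isoT. Qed.

Lemma composition_point_mass x y : T (point_mass x) y = (psi y == x)%:R.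
Proof. by rewrite T_psi. Qed.

(** [<T f, T e_x>] only sees [T f] on [psi^-1(x)], where it is constantly
    [f x]. *)
Lemma Delta_diagonal f x :
  fun_of_L2 (Delta dot T f) x = Delta_symbol x * f x.
Proof.
rewrite -(L2_scaleE _ f); apply: dot_eq_point_mass.
rewrite [RHS]dot_point_mass L2_scaleE mulrAC divfK ?gt_eqF ?weight_gt0//.
rewrite mulrC /defect !dot_Delta// mulrBr (dot_point_mass f); congr (_ - _).
rewrite -linearZl_LR; apply: L2_inner_eq => y.
rewrite L2_scaleE composition_point_mass T_psi.
by have [->|_] := eqVneq; rewrite ?mulr1// !rmorph0 !mulr0.
Qed.

Lemma defect_ge0 x : 0 <= defect x.
Proof. exact: two_isometric_Delta_ge0. Qed.

Lemma Delta_symbol_ge0 x : 0 <= Delta_symbol x.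
Proof. by rewrite divr_ge0 ?defect_ge0 ?ltW ?weight_gt0. Qed.

(** Both sides of the regularity equation multiply [f \o psi] by a function:
    by the symbol on the left, and on the right by its square root at [x],
    applied after [T], times its square root at [psi x], applied before. *)
Lemma Delta_regular_symbol : Delta_regular dot T <-> forall x,
  Delta_symbol x = sqrtC (Delta_symbol x) * sqrtC (Delta_symbol (psi x)).
Proof.
have sqrtE := op_sqrt_diagonal Delta_diagonal Delta_symbol_ge0 bndT.
have {}sqrtE f x : fun_of_L2 (op_sqrt dot (Delta dot T) f) x
    = sqrtC (Delta_symbol x) * f x.
  by apply: sqrtE => g; rewrite dot_Delta// gerBl dnorm_ge0.
split=> [regT x|symb f].
  have := congr1 (fun f => fun_of_L2 f x) (regT (point_mass (psi x))).
  rewrite Delta_diagonal sqrtE !T_psi sqrtE point_massE eqxx.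
  by rewrite !mulr1.
apply: L2_ext => x.
by rewrite Delta_diagonal sqrtE !T_psi sqrtE mulrA -symb.
Qed.

Lemma point_mass_composition {x y} : (forall z, (psi z == x) = (z == y)) ->
  T (point_mass x) = point_mass y.
Proof. by move=> xy; apply: L2_ext => z; rewrite composition_point_mass xy. Qed.

Lemma defect_composition {x y} : (forall z, (psi z == x) = (z == y)) ->
  defect y = defect x.
Proof.
move=> /point_mass_composition xy.
by rewrite /defect -xy two_isometric_dot_Delta.
Qed.

Lemma weight_composition {x y} : (forall z, (psi z == x) = (z == y)) ->
  weight y = weight x + defect x.
Proof.
move=> /point_mass_composition xy.
by rewrite /defect dot_Delta// addrC subrK /weight -xy.
Qed.

(** The right-hand side is [mu(psi^-1(x))]. *)
Lemma weight_preimages {x y z} : y != z -> psi y = x -> psi z = x ->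
  weight y + weight z <= weight x + defect x.
Proof.
move=> yz yx zx; rewrite /defect dot_Delta// [leRHS]addrC subrK.
apply: (@diagonal_form_ge2 id (fun=> 1)) => //.
- by move=> f t; rewrite mul1r.
- by rewrite composition_point_mass yx eqxx.
- by rewrite composition_point_mass zx eqxx.
Qed.

(** [T e_x] is 1 at [x] and at [y], so that
    [defect x + defect y <= <Delta_T T e_x, T e_x> = defect x]. *)
Lemma defect_preimage_fixpoint {x y} : psi x = x -> psi y = x -> y != x ->
  defect y = 0.
Proof.
move=> xx yx y_neq_x; apply/eqP; rewrite eq_le defect_ge0 andbT.
rewrite -(lerD2r (defect x)) add0r -[leRHS]two_isometric_dot_Delta//.
apply: (diagonal_form_ge2 Delta_diagonal Delta_symbol_ge0) => //.
- by rewrite composition_point_mass yx eqxx.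
- by rewrite composition_point_mass xx eqxx.
Qed.

End composition_operators.

End L2_vertices.

(** * The graph with one circuit *)

Section one_circuit.
Context {kappa : nat} {hk : (0 < kappa)%N} {eta : option nat}.
Local Notation X := (vertex hk eta).
Implicit Types (i j : 'I_kappa) (b : branch_index eta).

Definition circuit_end : 'I_kappa := Ordinal (etrans (ltn_predL kappa) hk).

Lemma ord_pred_eq i j : (ord_pred j == i) =
  (if (i.+1 < kappa)%N then j == i.+1 :> nat else j == 0%N :> nat).
Proof.
rewrite -val_eqE /=; have [->|j_gt0] := posnP j.
  rewrite add0n modn_small ?ltn_predL//.
  by case: ltnP => [|]; have := ltn_ord i; lia.
rewrite (_ : (j + kappa).-1 = j.-1 + kappa)%N; last by lia.
rewrite modnDr modn_small; last by have := ltn_ord j; lia.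
by case: ltnP => [|]; have := ltn_ord i; have := ltn_ord j; lia.
Qed.

Lemma phi_eq_branch b k (z : X) : (phi z == Branch b k) = (z == Branch b k.+1).
Proof.
by case: z => [i|c [|m]]; apply/eqP/eqP => // -[-> ->].
Qed.

Lemma phi_eq_circuit i j (z : X) : j = i.+1 :> nat ->
  (phi z == Circ i) = (z == Circ j).
Proof.
move=> ji; case: z => [m|c [|m]] /=.
- apply/eqP/eqP => -[]; last first.
    by move=> ->; congr Circ; apply/eqP; rewrite ord_pred_eq -ji ltn_ord.
  move=> /eqP; rewrite ord_pred_eq -ji ltn_ord => /eqP mj.
  by congr Circ; exact: val_inj.
- by apply/eqP => -[iE]; have := ltn_ord j; rewrite ji -iE /=; lia.
- exact/eqP/eqP.
Qed.

Lemma phi_circuit_start i : i = 0%N :> nat -> phi (Circ i : X) = Circ circuit_end.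
Proof.
move=> i0; congr Circ; apply/eqP.
by rewrite ord_pred_eq /= prednK// ltnn i0.
Qed.

End one_circuit.

Arguments circuit_end {kappa} hk.

Section proposition.
Context {R : realType} {kappa : nat} {hk : (0 < kappa)%N} {eta : option nat}.
Local Notation X := (vertex hk eta).
Context {mu : {measure set X -> \bar R}}.
Context {hmu : forall x : X, (0 < mu [set x] < +oo)%E}.
Local Notation dot := (L2_dot hmu).
Context {T : L2 mu -> L2 mu}.
Hypothesis T_phi : is_composition_operator (@phi kappa hk eta) T.
Hypothesis bndT : bounded_operator dot T.
Hypothesis isoT : two_isometric dot T.
Local Notation weight := (weight hmu).
Local Notation defect := (@defect _ _ _ _ _ hmu T).
Local Notation symbol := (@Delta_symbol _ _ _ _ _ hmu T).

(** The symbol is zero except at the circuit vertex, which [phi] fixes. *)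
Lemma Delta_regular_loop : kappa = 1%N -> Delta_regular dot T.
Proof.
move=> kappa1; have circ_eq (i j : 'I_kappa) : i = j.
  by apply: val_inj; have := ltn_ord i; have := ltn_ord j; rewrite /=; lia.
pose x1 : X := Circ (circuit_end hk).
have phi_x1 : phi x1 = x1 by congr Circ.
have branch0 b k : defect (Branch b k) = 0.
  elim: k => [|k IHk]; last first.
    by rewrite (defect_composition hmu T_phi isoT (phi_eq_branch b k)).
  exact: (defect_preimage_fixpoint hmu T_phi isoT phi_x1).
apply/(Delta_regular_symbol hmu T_phi bndT isoT) => -[i|b k].
  by rewrite (circ_eq i (circuit_end hk)) phi_x1 -expr2 sqrtCK.
by rewrite {1 2}/Delta_symbol branch0 mul0r sqrtC0 mul0r.
Qed.

Lemma circuit_defect i :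
  defect (Circ i) = defect (Circ (circuit_end hk)).
Proof.
move: {2}(kappa.-1 - i)%N (erefl (kappa.-1 - i)%N) => n.
elim: n i => [|n IHn] i ni.
  congr (defect (Circ _)); apply: val_inj; have := ltn_ord i; rewrite /=; lia.
have i1 : (i.+1 < kappa)%N by lia.
rewrite -(IHn (Ordinal i1)) /=; last by lia.
have pre_i z := @phi_eq_circuit _ hk eta i (Ordinal i1) z erefl.
by rewrite (defect_composition hmu T_phi isoT pre_i).
Qed.

Lemma circuit_weight i : defect (Circ (circuit_end hk)) = 0 ->
  weight (Circ i) = weight (Circ (circuit_end hk)).
Proof.
move=> defect0; move: {2}(kappa.-1 - i)%N (erefl (kappa.-1 - i)%N) => n.
elim: n i => [|n IHn] i ni.
  congr (weight (Circ _)); apply: val_inj; have := ltn_ord i; rewrite /=; lia.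
have i1 : (i.+1 < kappa)%N by lia.
rewrite -(IHn (Ordinal i1)) /=; last by lia.
have pre_i z := @phi_eq_circuit _ hk eta i (Ordinal i1) z erefl.
rewrite (weight_composition hmu T_phi isoT pre_i).
by rewrite circuit_defect defect0 addr0.
Qed.

(** With [p] the vertex before the end [x] of the circuit, a nonzero defect
    would make the symbols at [x] and [p] equal.  Since the defects there agree,
    so would the masses, although they differ by the defect. *)
Lemma Delta_regular_circuit_end : (1 < kappa)%N -> Delta_regular dot T ->
  defect (Circ (circuit_end hk)) = 0.
Proof.
move=> kappa_gt1 /(Delta_regular_symbol hmu T_phi bndT isoT) symb.
have pP : (kappa.-2 < kappa)%N by lia.
pose p := Ordinal pP; set x : X := Circ (circuit_end hk).
have pre_p z : (phi z == Circ p) = (z == x).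
  by apply: phi_eq_circuit => /=; lia.
have phi_x : phi x = Circ p by apply/eqP; rewrite pre_p.
apply/eqP; apply: contraT => defect_neq0.
have symb_neq0 : symbol x != 0.
  by rewrite mulf_neq0// invr_neq0// gt_eqF// weight_gt0.
have : symbol x = symbol (Circ p).
  have := symb x; rewrite phi_x -{1}[symbol x]sqrtCK expr2.
  move=> /mulfI; rewrite sqrtC_eq0 => /(_ symb_neq0) /(congr1 (fun z => z ^+ 2)).
  by rewrite !sqrtCK.
rewrite /Delta_symbol circuit_defect => /(mulfI defect_neq0) /invr_inj.
rewrite (weight_composition hmu T_phi isoT pre_p) circuit_defect => /eqP.
by rewrite -subr_eq0 addrC addKr (negbTE defect_neq0).
Qed.

(** Otherwise the end of the circuit would have the same mass as its preimage,
    which contains the start of the circuit, of that mass as well, and the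
    first vertex of a branch. *)
Lemma Delta_regular_kappa1 : eta != Some 0%N -> Delta_regular dot T ->
  kappa = 1%N.
Proof.
move=> eta_neq0 regT; apply/eqP; rewrite eqn_leq hk andbT leqNgt.
apply/negP => kappa_gt1.
have defect0 := Delta_regular_circuit_end kappa_gt1 regT.
have b0 : in_branches eta 0%N.
  by case: eta eta_neq0 => [[|n]|].
pose b : branch_index eta := exist _ 0%N b0.
have := @weight_preimages _ _ _ _ _ hmu _ _ T_phi isoT (Circ (circuit_end hk))
  (Circ (Ordinal hk)) (Branch b 0%N) erefl
  (phi_circuit_start (Ordinal hk) erefl) erefl.
rewrite defect0 addr0 circuit_weight// gerDl; apply/negP.
by rewrite lt_geF ?weight_gt0.
Qed.

End proposition.

Theorem proposition4p7 (R : realType) (kappa : nat) (hkappa : (0 < kappa)%N)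
  (eta : option nat) (heta : eta != Some 0%N)
  (mu : {measure set (vertex hkappa eta) -> \bar R})
  (hmu : forall x : vertex hkappa eta, (0 < mu [set x] < +oo)%E)
  (C_phi : L2 mu -> L2 mu)
  (hC : is_composition_operator (@phi kappa hkappa eta) C_phi)
  (hB : bounded_operator (L2_dot hmu) C_phi)
  (h2 : two_isometric (L2_dot hmu) C_phi) :
  Delta_regular (L2_dot hmu) C_phi <-> kappa = 1%N.
Proof.
by split; [exact: Delta_regular_kappa1 | exact: Delta_regular_loop].
Qed.
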